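(* Let $G,H$ be topological Abelian groups, and suppose that (i) $\mathcal{N}_{GP}^{\sigma}(G)$ is a proper $\sigma$-ideal in $G$ (that is, $G\notin \mathcal{N}_{GP}^{\sigma}(G)$), and (ii) $H$ has a dense subgroup of finite rank. If $f\colon G\times H\to\mathbb{C}$ is a separately generalized polynomial function, then $f$ is a generalized polynomial on $G\times H$.
   Context: Groups are written additively. For a topological Abelian group $G$, a function $f\colon G\to\mathbb{C}$ and $h\in G$, put $\Delta_h f(x)=f(x+h)-f(x)$. A continuous function $f\colon G\to\mathbb{C}$ is a generalized polynomial if there is an integer $n\ge 0$ such that $\Delta_{h_1}\cdots\Delta_{h_{n+1}}f=0$ for every $h_1,\ldots,h_{n+1}\in G$. The set of generalized polynomials on $G$ is denoted by $\mathcal{GP}_G$. The product $G\times H$ carries the product topology and the coordinatewise group operation. For $f\colon G\times H\to\mathbb{C}$, the sections are $f_x\colon H\to\mathbb{C}$ and $f^y\colon G\to\mathbb{C}$, $f_x(y)=f^y(x)=f(x,y)$. The function $f$ is a separately generalized polynomial function if $f_x\in\mathcal{GP}_H$ for every $x\in G$ and $f^y\in\mathcal{GP}_G$ for every $y\in H$. For $p\colon G\to\mathbb{C}$ let $Z_p=\{x\in G: p(x)=0\}$. Let $\mathcal{N}_{GP}(G)=\{A\subset G: \text{there is } p\in\mathcal{GP}_G,\ p\ne 0 \text{ (not identically zero)},\ A\subset Z_p\}$, and let $\mathcal{N}_{GP}^{\sigma}(G)$ be the $\sigma$-ideal of subsets of $G$ generated by $\mathcal{N}_{GP}(G)$. The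 rank of an Abelian group means its torsion-free rank: the cardinality of a maximal independent system of elements of infinite order (it is $0$ if and only if the group is torsion). *)

(* Defs.v *)
From HB Require Import structures.
From mathcomp Require Import all_boot all_order all_algebra.
From mathcomp Require Import complex.
From mathcomp Require Import all_classical all_reals all_analysis.

Set Implicit Arguments.
Unset Strict Implicit.
Unset Printing Implicit Defensive.

Import Order.TTheory GRing.Theory Num.Theory.
Import numFieldNormedType.Exports.

Local Open Scope classical_set_scope.
Local Open Scope ring_scope.

(* Makes G * H, with the product topology and the coordinatewise operations of
   the library, a PreTopologicalZmodule: a topological space that is also an
   abelian group. The library's instance of topologicalZmodType on products is
   restricted to topological vector spaces, so the notions below, which do not
   use the continuity of the operations, are stated on PreTopologicalZmodule
   in order to apply to products of topological groups. *)
HB.saturate prod.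

(* The complex numbers are R[i]^o for R : realType; the alias ^o is what
   carries the topology of the modulus. *)

Definition Delta (R : realType) (G : zmodType) (h : G) (f : G -> R[i]^o) :
    G -> R[i]^o :=
  fun x => f (x + h) - f x.

Definition generalized_polynomial (R : realType)
    (G : PreTopologicalZmodule.type) (f : G -> R[i]^o) : Prop :=
  continuous f /\
  exists n : nat, forall hs : n.+1.-tuple G, forall x : G,
    foldr (@Delta R G) f hs x = 0.

Definition separately_generalized_polynomial (R : realType)
    (G H : PreTopologicalZmodule.type) (f : G * H -> R[i]^o) : Prop :=
  (forall x : G, generalized_polynomial (fun y : H => f (x, y))) /\
  (forall y : H, generalized_polynomial (fun x : G => f (x, y))).

Definition zero_set (R : realType) (G : Type) (p : G -> R[i]^o) : set G :=
  [set x | p x = 0].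

Definition NGP (R : realType) (G : PreTopologicalZmodule.type) :
    set (set G) :=
  [set A | exists p : G -> R[i]^o,
     [/\ generalized_polynomial p, exists x, p x <> 0 & A `<=` zero_set p]].
Arguments NGP R G : clear implicits.

Definition sigma_ideal (T : Type) (I : set (set T)) : Prop :=
  [/\ I set0,
      forall A B : set T, A `<=` B -> I B -> I A &
      forall A : (set T)^nat, (forall n, I (A n)) -> I (\bigcup_n A n)].

Definition NGP_sigma (R : realType) (G : PreTopologicalZmodule.type) :
    set (set G) :=
  smallest (@sigma_ideal G) (NGP R G).
Arguments NGP_sigma R G : clear implicits.

Definition infinite_order (V : zmodType) (x : V) : Prop :=
  forall n : nat, x *+ n = 0 -> n = 0%N.

(* As usual for abelian groups, independence asks each term n_i a_i of a
   vanishing finite combination to vanish, not each coefficient; for elements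
   of infinite order the two agree. *)
Definition independent (V : zmodType) (S : set V) : Prop :=
  forall (s : seq V) (c : V -> int), uniq s -> (forall x, x \in s -> S x) ->
    \sum_(x <- s) x *~ c x = 0 -> forall x, x \in s -> x *~ c x = 0.

Definition independent_system (V : zmodType) (D S : set V) : Prop :=
  [/\ S `<=` D, (forall x, S x -> infinite_order x) & independent S].

Definition maximal_independent_system (V : zmodType) (D S : set V) : Prop :=
  independent_system D S /\
  forall S' : set V, independent_system D S' -> S `<=` S' -> S' = S.

(* All maximal systems have the same cardinality, so it does not matter which
   one is tested for finiteness. *)
Definition finite_rank (V : zmodType) (D : set V) : Prop :=
  exists2 S : set V, maximal_independent_system D S & finite_set S.

(* Main.v *)
Require Import Defs.
From HB Require Import structures.
From mathcomp Require Import all_boot all_order all_algebra.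
From mathcomp Require Import complex.
From mathcomp Require Import all_classical all_reals all_analysis.
From mathcomp Require Import ring.

Set Implicit Arguments.
Unset Strict Implicit.
Unset Printing Implicit Defensive.

Import Order.TTheory GRing.Theory Num.Theory.
Import numFieldNormedType.Exports.

Local Open Scope classical_set_scope.
Local Open Scope ring_scope.

(** The sections f_x = f (x, .), as functions on H, have degrees that might a
    priori be unbounded in x.  They are not: G is the increasing union of the sets where
    the degree is less than n, so by hypothesis (i) one of these sets lies in no
    zero set of a nonzero generalized polynomial.  For fixed y and
    h_1, ..., h_n, the iterated difference of f_x at y is a generalized
    polynomial in x which vanishes on that set, hence everywhere; so all
    sections have degree less than n ([uniform_degree]).

    Finite rank now makes the space V of continuous functions on H of degree
    less than n finite-dimensional, in the following form: finitely many points
    Y determine an element of V ([finite_determining_set]).  Such points are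
    built by induction on n.  Let S be the maximal independent system of the
    dense subgroup D, and let q have degree less than n + 1 and vanish on
    0, Y and Y + S.  The differences of q by elements of S have degree less
    than n and vanish on Y, hence on D; so q is periodic on D modulo a
    subgroup K with D / K torsion, and a periodic function of this kind with
    finite degree is constant ([periodic_degree_lt_cst]), here equal to
    q 0 = 0.  Density of D and continuity extend this from D to H.

    Evaluations at the points of Y then separate the variables, as in Gaussian
    elimination ([separation_of_variables]): f (x, y) is a finite sum of
    products u x * v y with u a generalized polynomial on G and v in V.  Such a
    sum is continuous on G * H and of finite degree, because the products are. *)

(** * Degree and finite differences *)

Section Degree.
Variable R : realType.
Implicit Types (G H : zmodType) (n : nat).

(** The recursion strips the innermost difference, so that induction on n
    passes from f to [Delta h f]. *)
Fixpoint degree_lt G n (f : G -> R[i]^o) : Prop :=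
  if n is m.+1 then forall h, degree_lt m (Delta h f) else forall x, f x = 0.

Lemma degree_ltP G n (f : G -> R[i]^o) :
  degree_lt n f <->
  forall hs : n.-tuple G, forall x, foldr (@Delta R G) f hs x = 0.
Proof.
elim: n f => [|n IH] f /=.
  by split=> [f0 hs x|/(_ [tuple])//]; rewrite tuple0 /= f0.
split=> [fn hs x|fn h].
  rewrite -[tval hs]revK -[rev hs]/(tval (rev_tuple hs)).
  case/tupleP: (rev_tuple hs) => h t /=; rewrite rev_cons.
  by rewrite foldr_rcons; move/IH: (fn h) => /(_ (rev_tuple t) x).
apply/IH => hs x; have := fn [tuple of rcons hs h] x.
by rewrite /= foldr_rcons.
Qed.

Lemma degree_lt_ext G n (f g : G -> R[i]^o) :
  f =1 g -> degree_lt n f -> degree_lt n g.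
Proof. by move=> /funext ->. Qed.

Lemma degree_lt0 G n : degree_lt n (fun _ : G => 0 : R[i]^o).
Proof.
elim: n => [|n IH] //= h.
by apply: degree_lt_ext IH => x; rewrite /Delta subrr.
Qed.

Lemma degree_ltS G n (f : G -> R[i]^o) : degree_lt n f -> degree_lt n.+1 f.
Proof.
elim: n f => [|n IH] f fn h; last exact/IH/fn.
by move=> x; rewrite /Delta !fn subrr.
Qed.

Lemma degree_lt_le G m n (f : G -> R[i]^o) :
  (m <= n)%N -> degree_lt m f -> degree_lt n f.
Proof.
move=> /subnKC <- fm; elim: (n - m)%N => [|k IH]; first by rewrite addn0.
by rewrite addnS; exact: degree_ltS.
Qed.

Lemma degree_ltD G n (f g : G -> R[i]^o) :
  degree_lt n f -> degree_lt n g -> degree_lt n (fun x => f x + g x).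
Proof.
elim: n f g => [|n IH] f g fn gn; first by move=> x; rewrite fn gn addr0.
move=> h; apply: degree_lt_ext (IH _ _ (fn h) (gn h)) => x.
by rewrite /Delta; ring.
Qed.

Lemma degree_ltBZ G n (f g : G -> R[i]^o) (c : R[i]) :
  degree_lt n f -> degree_lt n g -> degree_lt n (fun x => f x - c * g x).
Proof.
elim: n f g => [|n IH] f g fn gn; first by move=> x; rewrite fn gn mulr0 subr0.
move=> h; apply: degree_lt_ext (IH _ _ (fn h) (gn h)) => x.
by rewrite /Delta; ring.
Qed.

(** Follows from the Leibniz rule
    Delta (f g) = f Delta g + Delta f g + Delta f Delta g.  The bound m + n
    instead of the sharp m + n - 1 spares a case distinction at 0. *)
Lemma degree_ltM G m n (f g : G -> R[i]^o) :
  degree_lt m f -> degree_lt n g -> degree_lt (m + n) (fun x => f x * g x).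
Proof.
elim: m n f g => [|m IHm] n f g fm gn.
  by apply: degree_lt_ext (degree_lt0 _ _) => x; rewrite fm mul0r.
elim: n f g fm gn => [|n IHn] f g fm gn.
  by apply: degree_lt_ext (degree_lt0 _ _) => x; rewrite gn mulr0.
move=> h.
have fDg : degree_lt (m + n.+1) (fun x => f x * Delta h g x).
  by rewrite addnS; exact: IHn fm (gn h).
have Dfg : degree_lt (m + n.+1) (fun x => Delta h f x * g x).
  exact: IHm (fm h) gn.
have DfDg : degree_lt (m + n.+1) (fun x => Delta h f x * Delta h g x).
  exact: IHm (fm h) (degree_ltS (gn h)).
apply: degree_lt_ext (degree_ltD (degree_ltD fDg Dfg) DfDg) => x.
by rewrite /Delta; ring.
Qed.

Lemma degree_lt_pullback G H n (u : H -> G) (f : G -> R[i]^o) :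
  {morph u : x y / x + y} -> degree_lt n f -> degree_lt n (f \o u).
Proof.
move=> uD; elim: n f => [|n IH] f fn; first by move=> x; exact: fn.
move=> h; apply: degree_lt_ext (IH _ (fn (u h))) => x.
by rewrite /Delta /= uD.
Qed.

Lemma degree_lt_cst G (c : R[i]^o) : degree_lt 1 (fun _ : G => c).
Proof. by move=> h x; rewrite /Delta subrr. Qed.

End Degree.

(** * The algebra of generalized polynomials *)

Section Algebra.
Variable R : realType.
Implicit Types G H : PreTopologicalZmodule.type.

Lemma generalized_polynomialP G (f : G -> R[i]^o) :
  generalized_polynomial f <-> continuous f /\ exists n, degree_lt n f.
Proof.
split=> -[fc [n fn]]; split => //.
  by exists n.+1; exact/degree_ltP.
by exists n; exact/degree_ltP/degree_ltS.
Qed.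

Lemma generalized_polynomial_cst G (c : R[i]^o) :
  generalized_polynomial (fun _ : G => c).
Proof.
apply/generalized_polynomialP; split; first by move=> x; exact: cvg_cst.
by exists 1%N; exact: degree_lt_cst.
Qed.

Lemma generalized_polynomialD G (f g : G -> R[i]^o) :
  generalized_polynomial f -> generalized_polynomial g ->
  generalized_polynomial (fun x => f x + g x).
Proof.
move=> /generalized_polynomialP[fc [m fm]] /generalized_polynomialP[gc [n gn]].
apply/generalized_polynomialP; split.
  by move=> x; apply: cvgD; [exact: fc|exact: gc].
exists (maxn m n); apply: degree_ltD.
  exact: degree_lt_le (leq_maxl _ _) fm.
exact: degree_lt_le (leq_maxr _ _) gn.
Qed.

Lemma generalized_polynomialM G (f g : G -> R[i]^o) :
  generalized_polynomial f -> generalized_polynomial g ->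
  generalized_polynomial (fun x => f x * g x).
Proof.
move=> /generalized_polynomialP[fc [m fm]] /generalized_polynomialP[gc [n gn]].
apply/generalized_polynomialP; split.
  by move=> x; apply: (@cvgM R[i]); [exact: fc|exact: gc].
by exists (m + n)%N; exact: degree_ltM.
Qed.

Lemma generalized_polynomialB G (f g : G -> R[i]^o) :
  generalized_polynomial f -> generalized_polynomial g ->
  generalized_polynomial (fun x => f x - g x).
Proof.
move=> fP gP.
have := generalized_polynomialD fP
  (generalized_polynomialM (generalized_polynomial_cst G (-1)) gP).
by under eq_fun do rewrite mulN1r.
Qed.

Lemma generalized_polynomial_pullback G H (u : H -> G) (f : G -> R[i]^o) :
  continuous u -> {morph u : x y / x + y} ->
  generalized_polynomial f -> generalized_polynomial (f \o u).
Proof.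
move=> uc uD /generalized_polynomialP[fc [n fn]].
apply/generalized_polynomialP; split.
  by move=> x; apply: continuous_comp; [exact: uc|exact: fc].
by exists n; exact: degree_lt_pullback.
Qed.

Lemma generalized_polynomial_tensor G H (u : G -> R[i]^o) (v : H -> R[i]^o) :
  generalized_polynomial u -> generalized_polynomial v ->
  generalized_polynomial (fun z : G * H => u z.1 * v z.2).
Proof.
move=> uP vP; apply: generalized_polynomialM.
  apply: (@generalized_polynomial_pullback _ _ fst u) => // z; exact: cvg_fst.
apply: (@generalized_polynomial_pullback _ _ snd v) => // z; exact: cvg_snd.
Qed.

End Algebra.

(** * A uniform bound on the degree of the sections *)

Section UniformDegree.
Variable R : realType.

(** A proper sigma-ideal cannot contain all the members of a countable cover;
    so one member lies outside the ideal, hence outside its generators. *)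
Lemma nonnull_stratum (G : PreTopologicalZmodule.type) (A : (set G)^nat) :
  ~ NGP_sigma R G [set: G] -> \bigcup_n A n = [set: G] ->
  exists n, ~ NGP R G (A n).
Proof.
move=> Gproper AT; apply: contrapT => /forallNP AN; apply: Gproper => I [I_sigma NI].
case: I_sigma => _ _ Icup; rewrite -AT; apply: Icup => n.
by apply: NI; apply: contrapT; exact: AN.
Qed.

Lemma generalized_polynomial_section_diff (G : PreTopologicalZmodule.type)
    (H : zmodType) (f : G -> H -> R[i]^o) (hs : seq H) (y : H) :
  (forall y, generalized_polynomial (f ^~ y)) ->
  generalized_polynomial (fun x => foldr (@Delta R H) (f x) hs y).
Proof.
move=> fP; elim: hs y => [|h hs IH] y; first exact: fP.
exact: generalized_polynomialB (IH _) (IH _).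
Qed.

(** An iterated difference in the second variable is a generalized polynomial
    in the first one, so it vanishes identically as soon as it vanishes on a
    set that is not in [NGP R G]. *)
Lemma uniform_degree (G : PreTopologicalZmodule.type) (H : zmodType)
    (f : G -> H -> R[i]^o) :
  ~ NGP_sigma R G [set: G] ->
  (forall x, exists n, degree_lt n (f x)) ->
  (forall y, generalized_polynomial (f ^~ y)) ->
  exists n, forall x, degree_lt n (f x).
Proof.
move=> Gproper fxP fyP.
have [|n nullN] := @nonnull_stratum G (fun n => [set x | degree_lt n (f x)]) Gproper.
  by rewrite -subTset => x _; have [n fxn] := fxP x; exists n.
exists n => x; apply/degree_ltP => hs y; apply: contrapT => fxhs; apply: nullN.
exists (fun x => foldr (@Delta R H) (f x) hs y); split; last 1 first.
- by move=> z /degree_ltP/(_ hs y).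
- exact: generalized_polynomial_section_diff.
- by exists x.
Qed.

End UniformDegree.

(** * Groups of finite rank and determining sets *)

Section FiniteRank.
Variable R : realType.
Implicit Type V : zmodType.

(** Packs the closure properties of a set into the structure that the lemmas
    [rpred*] expect; stating it with an existential keeps the structure opaque,
    so that [x \in D'] and [x \in D] are not confused during rewriting. *)
Lemma zmod_closed_set V (D : set V) :
  zmod_closed [in D] -> exists D' : zmodClosed V, forall x, D x = (x \in D').
Proof.
move=> Dz; pose Dzm := GRing.isZmodClosed.Build V [in D] Dz.
by exists (HB.pack_for (zmodClosed V) [in D] Dzm) => x; exact/esym/in_setE.
Qed.

(** If no positive multiple of d fell into K, then d would be independent of S
    and of infinite order, against maximality: a relation involving d would
    express a multiple of d through S.  Arguing with any subgroup K above S
    avoids writing elements of the span of S as linear combinations. *)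
Lemma torsion_mod_maximal_independent V (D S K : set V) (d : V) :
  maximal_independent_system D S -> zmod_closed [in K] -> S `<=` K ->
  D d -> exists2 m, (0 < m)%N & K (d *+ m).
Proof.
move=> [[SD Sinf Sind] Smax] Kz SK Dd; apply: contrapT => /forall2NP notors.
have tors m : (0 < m)%N -> ~ K (d *+ m) by move=> m0; case: (notors m).
have [K' KE] := zmod_closed_set Kz.
have KN x : K x -> K (- x) by rewrite !KE rpredN.
have dS : ~ S d by move=> /SK Kd; apply: (tors 1%N).
have torsz (c : int) : K (d *~ c) -> c = 0.
  case: c => [[|m]|m] // Kdc; first by case: (tors m.+1).
  by case: (tors m.+1) => //; move: Kdc => /KN; rewrite NegzE mulrNz opprK.
have indS' : independent_system D (d |` S).
  split; first by move=> x [->//|/SD].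
    move=> x [->|/Sinf//] n dn0.
    by case: n dn0 => // n dn0; case: (tors n.+1) => //; rewrite dn0 KE rpred0.
  move=> t c t_uniq tS' sum0.
  have [dt|dNt] := boolP (d \in t); last first.
    apply: Sind sum0 => // x xt; case: (tS' x xt) => // xd.
    by move: dNt; rewrite -xd xt.
  have remS x : x \in rem d t -> S x.
    by rewrite mem_rem_uniq// inE => /andP[/eqP xd /tS'[]].
  move: sum0; rewrite (big_rem d)//= => sum0.
  have cd0 : c d = 0.
    apply: torsz; move/eqP: sum0; rewrite addr_eq0 => /eqP ->; apply: KN.
    rewrite KE big_seq rpred_sum// => x xt.
    by rewrite rpredMz// -KE; exact/SK/remS.
  rewrite cd0 mulr0z add0r in sum0.
  move=> x xt; have [->|xd] := eqVneq x d; first by rewrite cd0.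
  by apply: Sind sum0 _ _; rewrite ?rem_uniq// mem_rem_uniq// inE xd.
apply: dS; rewrite -(Smax _ indS' (@subsetUr _ _ _)); by left.
Qed.

(** The differences of q are periodic too, so by induction on the degree they
    are constant on D.  Hence q (j x) = q 0 + j c along the multiples of x;
    taking j with j x in K, periodicity gives j c = 0, so c = 0. *)
Lemma periodic_degree_lt_cst V (D K : set V) n (q : V -> R[i]^o) :
  zmod_closed [in D] -> (forall d, D d -> exists2 m, (0 < m)%N & K (d *+ m)) ->
  degree_lt n q -> (forall x k, D x -> K k -> q (x + k) = q x) ->
  forall x, D x -> q x = q 0.
Proof.
move=> Dz tors; have [D' DE] := zmod_closed_set Dz.
have DD x y : D x -> D y -> D (x + y) by rewrite !DE; exact: rpredD.
have D0 : D 0 by rewrite DE rpred0.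
elim: n q => [|n IH] q qn qper x Dx; first by rewrite !qn.
have Delta_cst y : D y -> Delta x q y = Delta x q 0.
  apply: IH y; first exact: qn.
  by move=> y k Dy Kk; rewrite /Delta addrAC !(qper _ k)//; exact: DD.
have [m m0 Kxm] := tors x Dx.
have qmul j : q (x *+ j) = q 0 + Delta x q 0 *+ j.
  elim: j => [|j IHj]; first by rewrite !mulr0n addr0.
  have Dxj : D (x *+ j) by rewrite DE rpredMn -?DE.
  have := Delta_cst _ Dxj; rewrite [LHS]/Delta -mulrSr => /eqP.
  by rewrite subr_eq IHj => /eqP ->; rewrite mulrS addrCA.
have := qmul m; rewrite -[x *+ m]add0r qper// => /esym/eqP.
rewrite -subr_eq0 addrAC subrr add0r mulrn_eq0 eqn0Ngt m0/=.
by rewrite /Delta add0r subr_eq0 => /eqP.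
Qed.

(** Amounts to the finite dimension of the space of functions of degree less
    than n on D.  From a set Y for n, the set 0, Y, Y + S works for n + 1: the
    differences by S of a function that vanishes there are zero on D, so the
    group of its periods contains S, has torsion quotient in D by maximality
    of S, and the function is constant on D. *)
Lemma finite_determining_set V (D : set V) n :
  zmod_closed [in D] -> finite_rank D ->
  exists Y : seq V, forall q : V -> R[i]^o, degree_lt n q ->
    (forall y, y \in Y -> q y = 0) -> forall x, D x -> q x = 0.
Proof.
move=> Dz [S Smax /finite_seqP[s Ss]].
have [D' DE] := zmod_closed_set Dz.
have SD : S `<=` D by case: Smax => -[].
elim: n => [|n [Y YP]]; first by exists [::] => q qn _ x _; exact: qn.
exists (0 :: Y ++ [seq y + z | y <- Y, z <- s]) => q qn qY.
have q_per_S x z : D x -> S z -> q (x + z) = q x.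
  move=> Dx Sz; apply/eqP; rewrite -subr_eq0; apply/eqP.
  apply: (YP (Delta z q) (qn z)) => // y Yy; rewrite /Delta !qY ?subrr//.
    by rewrite inE mem_cat Yy orbT.
  rewrite inE mem_cat; apply/or3P/Or33/allpairsP; exists (y, z); split => //=.
  by move: Sz; rewrite Ss.
pose K := [set k | D k /\ forall x, D x -> q (x + k) = q x].
have KE x : x \in [in K] <-> K x by rewrite in_setE.
have Kz : zmod_closed [in K].
  split=> [|k l]; rewrite ?KE.
    by split=> [|x _]; rewrite ?addr0// DE rpred0.
  move=> [Dk kper] [Dl lper]; split; first by rewrite DE rpredB -?DE.
  move=> x Dx; have Dxk : D (x + k - l) by rewrite DE rpredB ?rpredD -?DE.
  by rewrite addrA -lper// subrK kper.
have SK : S `<=` K by move=> z Sz; split=> [|x Dx]; [exact: SD|exact: q_per_S].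
move=> x Dx; rewrite (@periodic_degree_lt_cst V D K n.+1 q) ?qY ?mem_head//.
  by move=> d; exact: torsion_mod_maximal_independent Smax Kz SK.
by move=> y k Dy [_]; exact.
Qed.

End FiniteRank.

(** * Separation of variables *)

Lemma dense_continuous_eq0 (R : realType) (T : topologicalType) (D : set T)
    (q : T -> R[i]^o) :
  dense D -> continuous q -> (forall x, D x -> q x = 0) -> forall x, q x = 0.
Proof.
move=> Ddense qc qD x; apply: contrapT => qx.
have [||y [qy Dy]] := Ddense (q @^-1` [set~ 0]); first by exists x.
  apply: open_comp; first by move=> y _; exact: qc.
  apply: closed_openC; apply: accessible_closed_set1.
  exact/hausdorff_accessible/norm_hausdorff.
by apply: qy; exact: qD.
Qed.

(** Induction on the determining points.  If some [f x0] does not vanish at the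
    point y0, subtracting from f the product of [f ^~ y0] / f x0 y0 and [f x0]
    produces a function whose sections lie in the subspace of V of functions
    that vanish at y0, and this subspace is determined by the remaining
    points. *)
Lemma separation_of_variables (F : fieldType) (X : Type) (Y : eqType)
    (ys : seq Y) (U : set (X -> F)) (V : set (Y -> F)) (f : X -> Y -> F) :
  U (fun=> 0) -> V (fun=> 0) ->
  (forall u w c, U u -> U w -> U (fun x => u x - w x * c)) ->
  (forall v w c, V v -> V w -> V (fun y => v y - c * w y)) ->
  (forall v, V v -> (forall y, y \in ys -> v y = 0) -> forall y, v y = 0) ->
  (forall x, V (f x)) -> (forall y, U (f ^~ y)) ->
  exists (k : nat) (u : nat -> X -> F) (v : nat -> Y -> F),
    [/\ forall i, U (u i), forall i, V (v i) &
        forall x y, f x y = \sum_(i < k) u i x * v i y].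
Proof.
move=> U0 V0 UB; elim: ys V f V0 => [|y0 ys IH] V f V0 VB ysV fV fU.
  exists 0%N, (fun=> fun=> 0), (fun=> fun=> 0); split=> // x y.
  by rewrite big_ord0; exact: ysV.
pose V' := V `&` [set v | v y0 = 0].
have V'0 : V' (fun=> 0) by [].
have V'B v w c : V' v -> V' w -> V' (fun y => v y - c * w y).
  by move=> [Vv v0] [Vw w0]; split; [exact: VB|rewrite /= v0 w0 mulr0 subr0].
have ysV' v : V' v -> (forall y, y \in ys -> v y = 0) -> forall y, v y = 0.
  move=> [Vv v0] vys; apply: ysV => // y.
  by rewrite inE => /predU1P[->|/vys].
have [f0|/existsNP[x0 /eqP fx0]] := pselect (forall x, f x y0 = 0).
  have fV' x : V' (f x) by split; [exact: fV|exact: f0].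
  have [k [u [v [uU vV fE]]]] := IH V' f V'0 V'B ysV' fV' fU.
  by exists k, u, v; split=> // i; have [] := vV i.
pose f' x y := f x y - f x y0 / f x0 y0 * f x0 y.
have f'V' x : V' (f' x).
  by split; [exact: VB|rewrite /f' /= mulfVK// subrr].
have f'U y : U (f' ^~ y).
  rewrite /f'; under eq_fun do rewrite -mulrA; exact: UB.
have [k [u [v [uU vV f'E]]]] := IH V' f' V'0 V'B ysV' f'V' f'U.
exists k.+1, (fun i => if i is j.+1 then u j else fun x => f x y0 / f x0 y0),
  (fun i => if i is j.+1 then v j else f x0); split.
- move=> [|i]//; have := UB _ _ (- (f x0 y0)^-1) U0 (fU y0).
  by under eq_fun do rewrite sub0r mulrN opprK.
- by move=> [|i]//; have [] := vV i.
- by move=> x y; rewrite big_ord_recl /= -f'E /f' addrC subrK.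
Qed.

Theorem theorem4 (R : realType) (G H : topologicalZmodType)
  (hG : ~ NGP_sigma R G [set: G])
  (hH : exists D : set H, [/\ zmod_closed [in D], dense D & finite_rank D])
  (f : G * H -> R[i]^o)
  (hf : separately_generalized_polynomial f) :
  generalized_polynomial f.
Proof.
have [fxP fyP] := hf; have [D [Dz Ddense Drank]] := hH.
have fxdeg x : exists n, degree_lt n (fun y => f (x, y)).
  by have /generalized_polynomialP[] := fxP x.
have [n fn] := uniform_degree (f := fun x y => f (x, y)) hG fxdeg fyP.
have [Y YP] := finite_determining_set R n Dz Drank.
pose V : set (H -> R[i]) := [set v | continuous (v : H -> R[i]^o) /\
  degree_lt n (v : H -> R[i]^o)].
pose U : set (G -> R[i]) := [set u | generalized_polynomial (u : G -> R[i]^o)].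
have U0 : U (fun=> 0) by exact: generalized_polynomial_cst.
have V0 : V (fun=> 0) by split; [move=> x; exact: cvg_cst|exact: degree_lt0].
have UB u w c : U u -> U w -> U (fun x => u x - w x * c).
  move=> uU wU; apply: generalized_polynomialB => //.
  apply: generalized_polynomialM => //; exact: generalized_polynomial_cst.
have VB v w c : V v -> V w -> V (fun y => v y - c * w y).
  move=> [vc vn] [wc wn]; split; last exact: degree_ltBZ.
  move=> x; apply: cvgB; first exact: vc.
  by apply: (@cvgM R[i]); [exact: cvg_cst|exact: wc].
have YV v : V v -> (forall y, y \in Y -> v y = 0) -> forall y, v y = 0.
  move=> [vc vn] vY; apply: dense_continuous_eq0 Ddense vc _; exact: YP.
have fV x : V (fun y => f (x, y)) by split; [have [] := fxP x|exact: fn].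
have [k [u [v [uU vV fE]]]] :=
  separation_of_variables (f := fun x y => f (x, y)) U0 V0 UB VB YV fV fyP.
have -> : f = fun z => \sum_(i < k) u i z.1 * v i z.2.
  by apply/funext => -[x y]; exact: fE.
elim: k {fE} => [|k IH].
  by under eq_fun do rewrite big_ord0; exact: generalized_polynomial_cst.
under eq_fun do rewrite big_ord_recr /=.
apply: generalized_polynomialD => //; apply: generalized_polynomial_tensor.
  exact: uU.
by have [vc vn] := vV k; apply/generalized_polynomialP; split => //; exists n.
Qed.
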